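(* Let $\mathbf X\subset\mathbb R^n$ be compact, let $\mu$ be a Borel probability measure on $\mathbf X$ with moment sequence $\mathbf y$, let $d\ge 0$ be an even integer, let $\epsilon\in[0,1)$, and let $\gamma_\epsilon=\frac{1}{1-\epsilon}\binom{n+d/2}{n}$. Assume that the moment matrix $M_d(\mathbf y)$ is invertible. Then $$\mu\big(\{x: q_d^{\mathbf y}(x)\le\gamma_\epsilon\}\big)\ge\epsilon,$$ where $q_d^{\mathbf y}(x)=v_{d/2}(x)^\top M_d(\mathbf y)^{-1}v_{d/2}(x)$ is the Christoffel polynomial.
   Context: For $m\in\mathbb N$, $v_m(x)=(x^\alpha)_{|\alpha|\le m}$ is the vector of all monomials in $x\in\mathbb R^n$ of total degree at most $m$ (of length $\binom{n+m}{n}$). The moment sequence of $\mu$ is $\mathbf y_\alpha=\int_{\mathbf X}x^\alpha\,d\mu(x)$, $\alpha\in\mathbb N^n$. For $d$ even, the moment matrix is $M_d(\mathbf y)=\int_{\mathbf X}v_{d/2}(x)v_{d/2}(x)^\top\,d\mu(x)$, i.e. the symmetric matrix indexed by $|\alpha|,|\beta|\le d/2$ with entries $\mathbf y_{\alpha+\beta}$. *)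

(* Defs.v *)
From mathcomp Require Import all_boot all_order all_algebra.
From mathcomp Require Import all_classical all_reals all_analysis.

Set Implicit Arguments.
Unset Strict Implicit.
Unset Printing Implicit Defensive.

Import Order.TTheory GRing.Theory Num.Theory.
Import numFieldNormedType.Exports.

Local Open Scope classical_set_scope.
Local Open Scope ring_scope.

(* R^n with its Borel sigma-algebra, generated by the open sets of the
   product topology on row vectors. *)
Definition borel_rV (R : realType) (n : nat) :=
  g_sigma_algebraType (@open 'rV[R]_n).

Definition monomial (R : realType) (n : nat) (a : 'I_n -> nat)
    (x : 'rV[R]_n) : R :=
  \prod_(i < n) x 0 i ^+ a i.

(* Multi-indices a in N^n with |a| <= m. Each entry is then at most m, so
   entries in 'I_m.+1 lose nothing; this is the set whose cardinality
   'C(n + m, n) is given by card_partial_ord_partitions. *)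
Definition multi_index (n m : nat) :=
  {a : n.-tuple 'I_m.+1 | (\sum_(i <- a) i <= m)%N}.

Definition mi_val (n m : nat) (a : multi_index n m) (i : 'I_n) : nat :=
  tnth (val a) i.

Definition mi_size (n m : nat) : nat := #|{: multi_index n m}|.

(* The k-th multi-index, in the (arbitrary but fixed) order of enum. *)
Definition mi_nth (n m : nat) (k : 'I_(mi_size n m)) : 'I_n -> nat :=
  mi_val (enum_val k).

Definition monomial_vec (R : realType) (n m : nat) (x : 'rV[R]_n) :
    'cV[R]_(mi_size n m) :=
  \col_k monomial (mi_nth k) x.

Definition moment (R : realType) (n : nat) (X : set 'rV[R]_n)
    (mu : probability (borel_rV R n) R) (a : 'I_n -> nat) : R :=
  \int[mu]_(x in X) monomial a x.

Definition moment_mx (R : realType) (n d : nat) (y : ('I_n -> nat) -> R) :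
    'M[R]_(mi_size n d./2) :=
  \matrix_(k, l) y (fun i => (mi_nth k i + mi_nth l i)%N).

Definition christoffel (R : realType) (n d : nat) (y : ('I_n -> nat) -> R)
    (x : 'rV[R]_n) : R :=
  ((monomial_vec d./2 x)^T *m invmx (moment_mx d y)
     *m monomial_vec d./2 x) 0 0.

(* Main.v *)
Require Import Defs.
From mathcomp Require Import all_boot all_order all_algebra.
From mathcomp Require Import all_classical all_reals all_analysis.
Set Implicit Arguments.
Unset Strict Implicit.
Unset Printing Implicit Defensive.
Import Order.TTheory GRing.Theory Num.Theory.
Import numFieldNormedType.Exports.
Local Open Scope classical_set_scope.
Local Open Scope ring_scope.

(** Let [N] be the number of monomials of degree at most [d/2] and [M] the
    moment matrix, which is the Gram matrix of the monomial vector [v] in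
    L^2(mu).  Integrating a quadratic form against a Gram matrix gives a trace
    ([Rintegral_quad_form]), so the Christoffel polynomial [v^T M^-1 v] has
    integral [tr (M^-1 M) = N] over [X].  It is nonnegative, because
    [M^-1 = M^-1 M M^-1] and a Gram matrix is positive semidefinite
    ([inv_gram_form_ge0]).  Markov's inequality then bounds the measure of
    the set where it is at least [gamma] by [N / gamma]
    ([inv_gram_form_markov]).  Counting multi-indices gives
    [N = 'C(n + d/2, n)], so that this bound is [1 - eps], and the complement
    has measure at least [eps].  Compactness of [X] makes it a Borel set and all
    monomials bounded, hence integrable, on [X]. *)

Section GramMatrix.
Context d (T : measurableType d) (R : realType).
Variables (mu : {measure set T -> \bar R}) (D : set T) (N : nat).
Variable v : T -> 'cV[R]_N.
Hypothesis mD : measurable D.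
Hypothesis v_int :
  forall k l, mu.-integrable D (EFin \o (fun x => v x k 0 * v x l 0)).

Definition gram_mx : 'M[R]_N :=
  \matrix_(k, l) \int[mu]_(x in D) (v x k 0 * v x l 0).

Definition quad_form (A : 'M[R]_N) (x : T) : R := ((v x)^T *m A *m v x) 0 0.

Lemma quad_formE A x :
  quad_form A x = \sum_(p : 'I_N * 'I_N) A p.1 p.2 * (v x p.1 0 * v x p.2 0).
Proof.
rewrite -(pair_bigA _ (fun k l => A k l * (v x k 0 * v x l 0))) /=.
rewrite /quad_form -mulmxA !mxE; apply: eq_bigr => k _.
by rewrite !mxE mulr_sumr; apply: eq_bigr => l _; rewrite mulrCA.
Qed.

Let term_integrable (A : 'M[R]_N) (p : 'I_N * 'I_N) :
  mu.-integrable D (fun x => (A p.1 p.2 * (v x p.1 0 * v x p.2 0))%:E).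
Proof.
by under eq_fun do rewrite EFinM; apply: integrableZl => //; exact: v_int.
Qed.

Lemma integrable_quad_form A : mu.-integrable D (EFin \o quad_form A).
Proof.
have -> : EFin \o quad_form A = fun x =>
    (\sum_p (A p.1 p.2 * (v x p.1 0 * v x p.2 0))%:E)%E.
  by apply/funext => x /=; rewrite quad_formE -sumEFin.
by apply: integrable_sum => // p _; exact: term_integrable.
Qed.

Lemma gram_mx_sym : gram_mx^T = gram_mx.
Proof.
by apply/matrixP => k l; rewrite !mxE; apply: eq_Rintegral => x _; rewrite mulrC.
Qed.

(** The trace trick: [v^T A v = tr (A (v v^T))], and the integral commutes with
    the linear map [tr (A _)]. *)
Lemma Rintegral_quad_form A :
  \int[mu]_(x in D) quad_form A x = \tr (A *m gram_mx).
Proof.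
rewrite /Rintegral.
under eq_integral do rewrite quad_formE -sumEFin.
rewrite integral_sum// -sum_fine; last by move=> p _; exact: integrable_fin_num.
rewrite (eq_bigr (fun p : 'I_N * 'I_N => A p.1 p.2 * gram_mx p.2 p.1)).
  rewrite -(pair_bigA _ (fun k l => A k l * gram_mx l k)) /=.
  by apply: eq_bigr => k _; rewrite mxE.
move=> p _; rewrite -gram_mx_sym !mxE.
exact: RintegralZl.
Qed.

(** [w^T G w] is the integral of the square [(w^T v)^2], which is the quadratic
    form of [w w^T] at [v]. *)
Lemma gram_mx_ge0 (w : 'cV[R]_N) : 0 <= (w^T *m gram_mx *m w) 0 0.
Proof.
rewrite -trace_mx11 mxtrace_mulC mulmxA -Rintegral_quad_form.
apply: Rintegral_ge0 => x _; rewrite /quad_form mulmxA -mulmxA mxE big_ord1.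
have -> : ((v x)^T *m w) 0 0 = (w^T *m v x) 0 0.
  by rewrite !mxE; apply: eq_bigr => k _; rewrite !mxE mulrC.
by rewrite -expr2 sqr_ge0.
Qed.

Hypothesis gram_unit : gram_mx \in unitmx.

Lemma inv_gram_form_ge0 x : 0 <= quad_form (invmx gram_mx) x.
Proof.
have := gram_mx_ge0 (invmx gram_mx *m v x).
by rewrite trmx_mul trmx_inv gram_mx_sym -!mulmxA mulKVmx // mulmxA.
Qed.

(** Markov's inequality, the integral being [tr (G^-1 G) = N]. *)
Lemma inv_gram_form_markov (c : R) : 0 < c ->
  (c%:E * mu (D `&` [set x | c <= quad_form (invmx gram_mx) x]%R)
     <= N%:R%:E)%E.
Proof.
move=> c0.
have q_int := integrable_quad_form (invmx gram_mx).
have qE x : `|(EFin \o quad_form (invmx gram_mx)) x|%E =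
            (quad_form (invmx gram_mx) x)%:E.
  by rewrite /= ger0_norm ?inv_gram_form_ge0.
have := le_integral_abse mu mD (measurable_int mu q_int) c0.
under eq_integral do rewrite qE.
have -> : (\int[mu]_(x in D) (quad_form (invmx gram_mx) x)%:E)%E = N%:R%:E.
  rewrite -[LHS]fineK ?integrable_fin_num//; congr (_%:E).
  by rewrite -[LHS]/(Rintegral _ _ _) Rintegral_quad_form mulVmx ?mxtrace1.
by under eq_set do rewrite qE lee_fin.
Qed.

End GramMatrix.

Lemma mi_size_bin (n m : nat) : mi_size n m = 'C(n + m, n).
Proof.
rewrite -card_partial_ord_partitions /mi_size card_sig cardsE.
by apply: eq_card.
Qed.

Lemma monomialD (R : realType) (n : nat) (a b : 'I_n -> nat) (x : 'rV[R]_n) :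
  monomial (fun i => (a i + b i)%N) x = monomial a x * monomial b x.
Proof. by rewrite -big_split; apply: eq_bigr => i _; rewrite exprD. Qed.

Lemma continuous_monomial (R : realType) (n : nat) (a : 'I_n -> nat) :
  continuous (@monomial R n a).
Proof.
apply: continuous_big => [x|i _ x].
  by apply: cvgM; [exact: cvg_fst|exact: cvg_snd].
apply: (@continuous_comp _ _ _ (fun x : 'rV[R]_n => x 0 i) (fun t => t ^+ a i)).
  exact: coord_continuous.
exact: exprn_continuous.
Qed.

Lemma compact_borel_rV (R : realType) (n : nat) (X : set 'rV[R]_n) :
  compact X -> measurable (X : set (borel_rV R n)).
Proof.
move=> /(compact_closed (@norm_hausdorff _ _)) cX.
rewrite -(setCK X); apply: measurableC; apply: sub_sigma_algebra.
exact: closed_openC.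
Qed.

Lemma continuous_borel_rV (R : realType) (n : nat) (f : 'rV[R]_n -> R) :
  continuous f -> measurable_fun setT (f : borel_rV R n -> R).
Proof.
move=> /continuousP cf; apply: (measurability _ (measurable_realfun.RGenOpens.measurableE R)).
move=> _ [_ [a [b ->] <-]]; rewrite setTI; apply: sub_sigma_algebra.
exact/cf/interval_open.
Qed.

Lemma continuous_integrable_rV (R : realType) (n : nat) (X : set 'rV[R]_n)
    (mu : probability (borel_rV R n) R) (f : 'rV[R]_n -> R) :
  compact X -> continuous f ->
  mu.-integrable (X : set (borel_rV R n)) (EFin \o f).
Proof.
move=> cX cf; have mX := compact_borel_rV cX.
apply: measurable_bounded_integrable => //.
- by rewrite (le_lt_trans (probability_le1 mu mX)) ?ltry.
- by apply: measurable_funTS; apply: continuous_borel_rV.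
- have /compact_bounded[M [_ fM]] :=
    continuous_compact (continuous_subspaceT cf) cX.
  by exists M; split; rewrite ?num_real // => r Mr x Xx; apply: (fM _ Mr); exists x.
Qed.

Theorem lemma1 (R : realType) (n : nat) (X : set 'rV[R]_n)
    (mu : probability (borel_rV R n) R) (d : nat) (eps : R) :
  compact X ->
  mu X = 1%E ->
  ~~ odd d ->
  0 <= eps < 1 ->
  moment_mx d (moment X mu) \in unitmx ->
  let gamma := (1 - eps)^-1 * 'C(n + d./2, n)%:R in
  (eps%:E <= mu (X `&` [set x | (christoffel d (moment X mu) x <= gamma)%R]))%E.
Proof.
move=> cX muX _ /andP[_ eps1] M_unit; cbv zeta; set gamma := _ * _.
have mX := compact_borel_rV cX.
pose v : borel_rV R n -> _ := @monomial_vec R n d./2.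
have vE x k l : v x k 0 * v x l 0 =
    monomial (fun i => (mi_nth k i + mi_nth l i)%N) x.
  by rewrite monomialD !mxE.
have v_int k l :
    mu.-integrable (X : set (borel_rV R n)) (EFin \o (fun x => v x k 0 * v x l 0)).
  rewrite (_ : (fun x => _) = monomial (fun i => (mi_nth k i + mi_nth l i)%N)).
    exact/continuous_integrable_rV/continuous_monomial.
  by apply/funext => x; exact: vE.
have gramE : moment_mx d (moment X mu) = gram_mx mu X v.
  apply/matrixP => k l; rewrite !mxE; apply: eq_Rintegral => x _.
  by rewrite vE.
have N0 : (0 < 'C(n + d./2, n))%N by rewrite bin_gt0 leq_addr.
have eps1' : 0 < 1 - eps by rewrite subr_gt0.
have gamma0 : 0 < gamma by rewrite mulr_gt0 ?invr_gt0 ?ltr0n.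
have q_int := integrable_quad_form mX v_int (invmx (gram_mx mu X v)).
rewrite gramE in M_unit.
have := inv_gram_form_markov mX v_int M_unit gamma0.
set q := quad_form v _ in q_int *; rewrite mi_size_bin.
have -> : christoffel d (moment X mu) = q by rewrite /christoffel gramE.
set B := (X in (_ * mu X)%E) => muB.
set C := (X in (_ <= mu X)%E).
have mq : measurable_fun (X : set (borel_rV R n)) q.
  by apply/measurable_realfun.measurable_EFinP; exact: measurable_int q_int.
have mB : measurable (B : set (borel_rV R n)).
  exact: measurable_fun_le (measurable_cst gamma) mq.
have mC : measurable (C : set (borel_rV R n)).
  exact: measurable_fun_le mq (measurable_cst gamma).
have {}muB : (mu B <= (1 - eps)%:E)%E.
  move: muB; rewrite -lee_pdivlMl// -EFinM /gamma invfM invrK -mulrA mulVf ?mulr1//.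
  by rewrite pnatr_eq0 -lt0n.
apply: (@le_trans _ _ (mu (X `\` B))); last first.
  apply: le_measure; rewrite ?inE//; first exact: measurableD.
  move=> x [Xx nBx]; split => //=; rewrite leNgt; apply/negP => qx.
  by apply: nBx; split => //=; exact: ltW.
rewrite measureD//; last by rewrite [X in (X < _)%E]muX ltry.
rewrite [X in (X - _)%E]muX setIidr; last by move=> x [].
have -> : eps%:E = (1%:E - (1 - eps)%:E)%E by rewrite -EFinB subKr.
exact: leeB.
Qed.
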